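(* Let $f:\mathbb{N}\to\mathbb{C}$ be a multiplicative function such that \[ f(x^2+xy+y^2) = f(x)^2+f(x)\,f(y)+f(y)^2 \] for all positive integers $x,y$. Then $f(n)=n$ for all $n\in\mathbb{N}$.
   Context: $\mathbb{N}$ denotes the set of positive integers. A function $f:\mathbb{N}\to\mathbb{C}$ is multiplicative if $f(1)=1$ and $f(mn)=f(m)f(n)$ for all coprime positive integers $m,n$. *)

(* Defs.v *)
From mathcomp Require Export all_boot all_order all_algebra.
From mathcomp Require Export reals.
From mathcomp.real_closed Require Export complex.

Set Implicit Arguments.
Unset Strict Implicit.
Unset Printing Implicit Defensive.

Local Open Scope ring_scope.

(* Arithmetic functions on the positive integers are represented as functions
   on nat whose value at 0 is never constrained.  The positivity conditions
   matter: in MathComp, coprime 0 1 and coprime 1 0 hold. *)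
Definition multiplicative_fun (A : pzSemiRingType) (f : nat -> A) : Prop :=
  f 1%N = 1 /\
  (forall m n : nat, (0 < m)%N -> (0 < n)%N -> coprime m n ->
     f (m * n)%N = f m * f n).

(* Main.v *)
(* Strong induction on n.  The value f(2) = 2 follows by comparing the identity
   at (1,2), (2,3), (1,4), (1,7) with 21 = 3 * 7 and 57 = 3 * 19.  By
   multiplicativity only prime powers n matter.  The identity with x = y gives f(3x^2) = 3 f(x)^2, and with y = 2x it gives
   f(7x^2) = 7 f(x)^2 for odd x; together they yield f(x^2) = f(x)^2.  So even
   powers are settled, as are powers of 3.  Every p = 1 (mod 3) is of the form
   x^2 + xy + y^2 with x, y > 0, hence so is every odd power of p.  If
   n = 2 (mod 3), multiplicativity and
     3 (x^2 + xy + y^2) = (x-y)^2 + (x-y)(x+2y) + (x+2y)^2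
   at (x, y) = (n, 1) and (n, 4) express f(n)^2 + f(n) and f(n)^2 + 4 f(n)
   through f at n-1, n+2, n-4, n+8; the arguments exceeding n are 1 (mod 3), so
   they are either prime powers already settled or products of coprime factors
   less than n.  Subtracting the two equations gives f(n) = n. *)
Require Import Defs.
From mathcomp Require Import all_fingroup all_solvable all_field.
From mathcomp Require Import zify ring.

Set Implicit Arguments.
Unset Strict Implicit.
Unset Printing Implicit Defensive.

Import Order.TTheory GRing.Theory Num.Theory.
Local Open Scope ring_scope.

(** * Primes congruent to 1 modulo 3 as Eisenstein norms *)

(** Cauchy's theorem gives a unit of order 3, since 3 divides p - 1; it is a root of X^3 - 1 other
    than 1. *)
Lemma Fp_cube_root_unity (p : nat) : prime p -> (p %% 3 = 1)%N ->
  exists z : 'F_p, z ^+ 2 + z + 1 = 0.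
Proof.
move=> p_pr p1.
have d3 : (3 %| #|[set: {unit 'F_p}]|)%N.
  by rewrite card_finField_unit card_Fp //; have := prime_gt0 p_pr; lia.
have [u _ ou] := Cauchy (isT : prime 3) d3.
have u3 : FinRing.uval u ^+ 3 = 1 by rewrite -FinRing.val_unitX -ou expg_order.
have u1 : FinRing.uval u != 1.
  by apply/eqP => /(@val_inj _ _ _ u 1%g) eu; move: ou; rewrite eu order1.
exists (FinRing.uval u); apply/eqP.
have /eqP : (FinRing.uval u - 1) * (FinRing.uval u ^+ 2 + FinRing.uval u + 1) = 0.
  by rewrite [LHS](_ : _ = FinRing.uval u ^+ 3 - 1); [rewrite u3 subrr | ring].
by rewrite mulf_eq0 subr_eq0 (negPf u1).
Qed.

Lemma sqr_not_prime (m : nat) : ~~ prime (m ^ 2).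
Proof.
apply/negP => /primeP [m1 /(_ m)]; rewrite dvdn_exp // => /(_ isT).
by case/orP => /eqP; nia.
Qed.

(** Pigeonhole: with s the integer square root of p, there are (s+1)^2 > p pairs in [0, s]^2, so two
    of them share the value u1 - z u2 in ['F_p]; their difference is (a, b). *)
Lemma Thue (p : nat) (z : 'F_p) : prime p ->
  exists a b : int, [/\ (a != 0) || (b != 0), a ^+ 2 < p%:Z, b ^+ 2 < p%:Z
    & a%:~R = z * b%:~R].
Proof.
move=> p_pr.
have [s s_lt lt_s] : exists2 s, (s ^ 2 < p)%N & (p < s.+1 ^ 2)%N.
  have ex : exists s, (p < s.+1 ^ 2)%N by exists p; lia.
  have psq m : p != (m ^ 2)%N.
    by apply: contraL p_pr => /eqP->; exact: sqr_not_prime.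
  case: (ex_minnP ex) => s lts mins; exists s => //.
  rewrite ltn_neqAle eq_sym psq leqNgt; case: s lts mins => [|s] _ // mins.
  by apply/negP => /mins; rewrite ltnn.
pose g (u : 'I_s.+1 * 'I_s.+1) : 'F_p := u.1%:R - z * u.2%:R.
have /injectivePn [u [v uv guv]] : ~~ injectiveb g.
  apply/negP => /injectiveP /leq_card.
  by rewrite card_Fp // card_prod !card_ord; lia.
exists (u.1%:Z - v.1%:Z), (u.2%:Z - v.2%:Z).
have := ltn_ord u.1; have := ltn_ord u.2.
have := ltn_ord v.1; have := ltn_ord v.2.
move=> h1 h2 h3 h4; split; [|nia|nia|].
- case: u v uv {guv h1 h2 h3 h4} => [a b] [c d] /=; rewrite xpair_eqE !subr_eq0.
  by rewrite negb_and.
- move: guv; rewrite /g !rmorphB /= -!pmulrn => /eqP.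
  by rewrite -subr_eq0 => /eqP h; apply/eqP; rewrite -subr_eq0 -h; apply/eqP; ring.
Qed.

(** For z a root of z^2 + z + 1, Thue's pair has norm divisible by p and strictly between 0 and 3p,
    which leaves p and 2p. *)
Lemma prime_int_eisenstein_norm (p : nat) : prime p -> (p %% 3 = 1)%N ->
  exists a b : int, a ^+ 2 + a * b + b ^+ 2 = p%:Z.
Proof.
move=> p_pr p1; have [z z0] := Fp_cube_root_unity p_pr p1.
have [a [b [ab0 ap bp eab]]] := Thue z p_pr.
have /dvdzP [k ek] : (p%:Z %| a ^+ 2 + a * b + b ^+ 2)%Z.
  rewrite (dvdz_pcharf (pchar_Fp p_pr)) !rmorphD !rmorphXn rmorphM /= eab.
  by rewrite -(mulr0 (b%:~R ^+ 2)) -z0; apply/eqP; ring.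
exists a, b; rewrite ek.
have p0 := prime_gt0 p_pr.
have N_gt0 : 0 < k * p%:Z.
  rewrite -ek; have := sqr_ge0 (a + b).
  have : 0 < a ^+ 2 \/ 0 < b ^+ 2 by rewrite !exprn_even_gt0 //; apply/orP.
  nia.
have N_lt : k * p%:Z < 3 * p%:Z by rewrite -ek; have := sqr_ge0 (a - b); nia.
have k0 : 0 < k by move: N_gt0; rewrite pmulr_lgt0 // ltz_nat.
have k3 : k < 3 by move: N_lt; rewrite ltr_pM2r // ltz_nat.
have [->|k2] : k = 1 \/ k = 2 by lia.
  by rewrite mul1r.
have [p2|p_odd] := even_prime p_pr; first by rewrite p2 in p1.
(* An even norm forces a and b to be even, so norm 2p would be divisible by 4, against p odd. *)
have : exists c d, a = 2 * c /\ b = 2 * d.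
  by exists (a %/ 2)%Z, (b %/ 2)%Z; nia.
case=> c [d [ec ed]]; exfalso; move: ek; rewrite ec ed k2; nia.
Qed.

(** None of a, b, a + b vanishes, as p is not a square. The signs of these three numbers then select
    a symmetry of the form that makes both coordinates positive. *)
Lemma prime_eisenstein_norm (p : nat) : prime p -> (p %% 3 = 1)%N ->
  exists x y : nat, [/\ (0 < x)%N, (0 < y)%N & p = (x ^ 2 + x * y + y ^ 2)%N].
Proof.
move=> p_pr p1; have [a [b eab]] := prime_int_eisenstein_norm p_pr p1.
have psq (m : int) : p%:Z != m ^+ 2.
  apply: contraL p_pr => /eqP e.
  by rewrite (_ : p = `|m|%N ^ 2)%N ?sqr_not_prime //; lia.
have a0 : a != 0 by apply/eqP => a0; case/eqP: (psq b); rewrite -eab a0; ring.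
have b0 : b != 0 by apply/eqP => b0; case/eqP: (psq a); rewrite -eab b0; ring.
have s0 : a + b != 0.
  by apply/eqP => s0; case/eqP: (psq a); rewrite -eab (_ : b = - a); [ring | lia].
suff [c [d [c0 d0 ecd]]] : exists c d : int,
    [/\ 0 < c, 0 < d & c ^+ 2 + c * d + d ^+ 2 = p%:Z].
  exists `|c|%N, `|d|%N; split; nia.
have [ap|an] := ltrP 0 a; have [bp|bn] := ltrP 0 b.
- by exists a, b.
- have [sp|sn] := ltrP 0 (a + b).
    by exists (a + b), (- b); split; [| lia | rewrite -eab; ring].
  by exists a, (- (a + b)); split; [| lia | rewrite -eab; ring].
- have [sp|sn] := ltrP 0 (a + b).
    by exists (a + b), (- a); split; [| lia | rewrite -eab; ring].
  by exists b, (- (a + b)); split; [| lia | rewrite -eab; ring].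
- by exists (- a), (- b); split; [lia | lia | rewrite -eab; ring].
Qed.

(** * Prime powers *)

Lemma prime_power_or_coprime_product (n : nat) : (1 < n)%N ->
  (exists p j, prime p /\ n = p ^ j)%N \/
  (exists a b, [/\ 1 < a, 1 < b, coprime a b & n = a * b])%N.
Proof.
move=> n1; have p_pr := pdiv_prime n1.
have n0 : (0 < n)%N by lia.
have [m cop en] := pfactor_coprime p_pr n0.
have l0 : (0 < logn (pdiv n) n)%N by rewrite logn_gt0 pi_pdiv.
have [m1|m1] := eqVneq m 1%N.
  by left; exists (pdiv n), (logn (pdiv n) n); split; rewrite // {1}en m1 mul1n.
right; exists m, (pdiv n ^ logn (pdiv n) n)%N; split=> //.
- by case: m en m1 {cop} => [|[]] //; lia.
- by rewrite -(exp1n (logn (pdiv n) n)) ltn_exp2r // prime_gt1.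
- by rewrite coprime_sym coprimeXl.
Qed.

(** For odd j, p^j = p r^2, and a representation of p is scaled by r. *)
Lemma prime_power_1mod3 (p j : nat) : prime p -> (p ^ j %% 3 = 1)%N ->
  (exists r, p ^ j = r ^ 2)%N \/
  (exists x y, [/\ 0 < x, 0 < y & p ^ j = x ^ 2 + x * y + y ^ 2])%N.
Proof.
move=> p_pr; rewrite -(odd_double_half j) -muln2 expnD expnM.
set r := (p ^ j./2)%N; have r0 : (0 < r)%N by rewrite expn_gt0 prime_gt0.
case: (odd j) => /=; last by move=> _; left; exists r; rewrite mul1n.
rewrite expn1 => h; right.
have p1 : (p %% 3 = 1)%N.
  have : (r %% 3 = 0 \/ r %% 3 = 1 \/ r %% 3 = 2)%N by lia.
  by case=> [|[]] er; move: h; rewrite -modnMmr -modnXm er ?muln0 ?muln1 //=; lia.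
have [x [y [x0 y0 ->]]] := prime_eisenstein_norm p_pr p1.
by exists (r * x)%N, (r * y)%N; split;
  [rewrite muln_gt0 r0 | rewrite muln_gt0 r0 | ring].
Qed.

(* The norm is passed through an equation on n so that numerical instances
   need no rewriting. *)
Definition eisenstein_commuting (K : pzSemiRingType) (f : nat -> K) : Prop :=
  forall x y n : nat, (0 < x)%N -> (0 < y)%N ->
    n = (x ^ 2 + x * y + y ^ 2)%N -> f n = f x ^+ 2 + f x * f y + f y ^+ 2.

Lemma multiplicative_funM (K : pzSemiRingType) (f : nat -> K) :
  multiplicative_fun f -> forall m n k : nat,
  (0 < m)%N -> (0 < n)%N -> coprime m n -> k = (m * n)%N -> f k = f m * f n.
Proof. by move=> [_ fM] m n k m0 n0 cop ->; apply: fM. Qed.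
Arguments multiplicative_funM {K f} _ m n k.

(** * Values at small arguments and at squares *)

Lemma commuting_3 (K : numFieldType) (f : nat -> K) :
  multiplicative_fun f -> eisenstein_commuting f -> f 3%N = 3%:R.
Proof.
by move=> [f1 _] fE; rewrite (fE 1%N 1%N 3%N) // f1; ring.
Qed.

Lemma commuting_4 (K : numFieldType) (f : nat -> K) :
  multiplicative_fun f -> eisenstein_commuting f -> f 4%N = f 2%N ^+ 2.
Proof.
move=> fM fE; have f3 := commuting_3 fM fE.
have := fE 2%N 2%N 12%N isT isT erefl.
rewrite (multiplicative_funM fM 3 4 12) // f3 => e.
by apply: (mulfI (x := 3%:R)); [rewrite pnatr_eq0 | rewrite e; ring].
Qed.

Lemma commuting_2 (K : numFieldType) (f : nat -> K) :
  multiplicative_fun f -> eisenstein_commuting f -> f 2%N = 2%:R.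
Proof.
move=> fM fE; have [f1 _] := fM.
have f3 := commuting_3 fM fE; have f4 := commuting_4 fM fE.
have f7 := fE 1%N 2%N 7%N isT isT erefl.
have f19 := fE 2%N 3%N 19%N isT isT erefl.
have f21 := fE 1%N 4%N 21%N isT isT erefl.
have f57 := fE 1%N 7%N 57%N isT isT erefl.
move: f21 f57; rewrite (multiplicative_funM fM 3 7 21) //.
rewrite (multiplicative_funM fM 3 19 57) // f19 f7 f4 f3 f1.
move: (f 2%N) => a e1 /eqP; rewrite -subr_eq0 => /eqP e2.
(* This is f(21) = f(3) f(7) factored. Inserting the unwanted roots into f(57) = f(3) f(19) yields
   18 = 0 for a = -1 and 427 = 0 for a^2 + a + 1 = 0. *)
have : (a - 2%:R) * (a + 1) * (a ^+ 2 + a + 1) = 0.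
  by move/eqP: e1; rewrite eq_sym -subr_eq0 => /eqP <-; ring.
move/eqP; rewrite !mulf_eq0 -orbA subr_eq0 => /or3P[/eqP //| |] /eqP a0; exfalso.
- have : 18%:R == 0 :> K.
    have {}a0 : a = -1 by apply/eqP; rewrite -addr_eq0 a0.
    by rewrite -e2 a0; apply/eqP; ring.
  by rewrite pnatr_eq0.
- have a6 : 6%:R * a + 23%:R = 0.
    rewrite -[RHS]e2 -[LHS](subr0 _) -(mulr0 (a ^+ 2 + a - 1)) -a0; ring.
  (* Up to sign, 427 is the remainder of 36 (a^2 + a + 1) on division by 6 a + 23. *)
  have : 427%:R == 0 :> K.
    rewrite (_ : _%:R = 36%:R * (a ^+ 2 + a + 1)
        - (6%:R * a + 23%:R) * (6%:R * a - 17%:R)).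
      by rewrite a0 a6 mulr0 mul0r subr0.
    ring.
  by rewrite pnatr_eq0.
Qed.

(** The pair (x, x) handles x prime to 3, and (x, 2x) handles odd x prime to 7. In general x = 3^k m
    with m prime to 3: the first applies to m, the second to 3^k. *)
Lemma commuting_sqr (K : numFieldType) (f : nat -> K) :
  multiplicative_fun f -> eisenstein_commuting f ->
  forall x : nat, (0 < x)%N -> f (x ^ 2)%N = f x ^+ 2.
Proof.
move=> fM fE; have f3 := commuting_3 fM fE; have f2 := commuting_2 fM fE.
have [f1 _] := fM.
have f7 : f 7%N = 7%:R by rewrite (fE 1%N 2%N 7%N) // f1 f2; ring.
have sqr3 x : (0 < x)%N -> coprime 3 x -> f (x ^ 2)%N = f x ^+ 2.
  move=> x0 cop; apply: (mulfI (x := 3%:R)); first by rewrite pnatr_eq0.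
  rewrite -f3 -(multiplicative_funM fM 3 (x ^ 2) (3 * x ^ 2))
    ?coprimeXr ?expn_gt0 ?x0 //.
  by rewrite (fE x x) //; [rewrite f3; ring | ring].
have sqr7 x : (0 < x)%N -> coprime 7 x -> coprime 2 x -> f (x ^ 2)%N = f x ^+ 2.
  move=> x0 cop7 cop2; apply: (mulfI (x := 7%:R)); first by rewrite pnatr_eq0.
  rewrite -f7 -(multiplicative_funM fM 7 (x ^ 2) (7 * x ^ 2))
    ?coprimeXr ?expn_gt0 ?x0 //.
  rewrite (fE x (2 * x)%N) ?muln_gt0 //; last by ring.
  by rewrite (multiplicative_funM fM 2 x (2 * x)%N) // f2 f7; ring.
move=> x x0; have [m cop3 ex] := pfactor_coprime (isT : prime 3) x0.
have m0 : (0 < m)%N by case: m cop3 ex => //; lia.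
set k := logn 3 x in ex.
have k0 : (0 < 3 ^ k)%N by rewrite expn_gt0.
have copk : coprime m (3 ^ k) by rewrite coprime_sym coprimeXl.
rewrite (multiplicative_funM fM (m ^ 2) ((3 ^ k) ^ 2) (x ^ 2)%N)
  ?expn_gt0 ?m0 ?k0 //.
- rewrite sqr3 // sqr7 ?coprimeXr //.
  by rewrite (multiplicative_funM fM m (3 ^ k) x) // exprMn.
- by rewrite coprimeXl // coprimeXr.
- by rewrite {1}ex; ring.
Qed.

(** * Residue classes modulo 3 *)

(** The norm N is congruent to (x - y)^2 modulo 3, hence prime to 3, so f(3N) = 3 f(N); 3N is itself
    the norm of (x - y, x + 2y). *)
Lemma commuting_triple (K : numFieldType) (f : nat -> K) :
  multiplicative_fun f -> eisenstein_commuting f ->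
  forall x y : nat, (0 < y < x)%N -> (x %% 3 != y %% 3)%N ->
  3%:R * (f x ^+ 2 + f x * f y + f y ^+ 2) =
  f (x - y)%N ^+ 2 + f (x - y)%N * f (x + 2 * y)%N + f (x + 2 * y)%N ^+ 2.
Proof.
move=> fM fE x y /andP[y0 yx] xy.
pose N := (x ^ 2 + x * y + y ^ 2)%N.
have x0 : (0 < x)%N by lia.
rewrite -(fE x y N) // -(commuting_3 fM fE) -(multiplicative_funM fM 3 N (3 * N)) //.
- by apply: fE; rewrite /N; nia.
- by rewrite /N; nia.
- rewrite prime_coprime // /dvdn /N.
  move: xy; rewrite (divn_eq x 3) (divn_eq y 3) !modnMDl !modn_mod.
  move: (ltn_pmod x (isT : 0 < 3)%N) (ltn_pmod y (isT : 0 < 3)%N).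
  move: (x %% 3)%N (y %% 3)%N (x %/ 3)%N (y %/ 3)%N => r s a b r3 s3 rs.
  rewrite (_ : (_ + _)%N = ((3 * a ^ 2 + 2 * a * r + 3 * a * b + a * s + b * r
    + 3 * b ^ 2 + 2 * b * s) * 3 + (r ^ 2 + r * s + s ^ 2))%N); last by ring.
  by rewrite modnMDl; move: rs r3 s3; case: r => [|[|[|]]] //; case: s => [|[|[|]]].
Qed.

Lemma commuting_prime_power_1mod3 (K : numFieldType) (f : nat -> K) :
  multiplicative_fun f -> eisenstein_commuting f ->
  forall p j : nat, prime p -> (p ^ j %% 3 = 1)%N ->
  (forall r, 0 < r -> r ^ 2 <= p ^ j -> f r = r%:R)%N ->
  f (p ^ j)%N = (p ^ j)%:R.
Proof.
move=> fM fE p j p_pr m1 IH.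
have m0 : (0 < p ^ j)%N by rewrite expn_gt0 prime_gt0.
have [[r er]|[x [y [x0 y0 exy]]]] := prime_power_1mod3 p_pr m1.
  have r0 : (0 < r)%N by move: m0; rewrite er expn_gt0 orbF.
  by rewrite er (commuting_sqr fM fE) // IH ?er // natrX.
rewrite (fE x y) // !IH ?exy //; [ring | lia | lia].
Qed.

Lemma commuting_2mod3 (K : numFieldType) (f : nat -> K) :
  multiplicative_fun f -> eisenstein_commuting f ->
  forall n : nat, (4 < n)%N -> (n %% 3 = 2)%N ->
  (forall m, m \in [:: n - 4; n - 1; n + 2; n + 8]%N -> f m = m%:R) ->
  f n = n%:R.
Proof.
move=> fM fE n n4 n2 IH; have [f1 _] := fM.
have f4 : f 4%N = 4%:R by rewrite (commuting_4 fM fE) (commuting_2 fM fE); ring.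
have y1 : (0 < 1 < n)%N by lia.
have y4 : (0 < 4 < n)%N by lia.
have := commuting_triple fM fE y4; have := commuting_triple fM fE y1.
rewrite n2 => /(_ isT) + /(_ isT).
rewrite f1 f4 (IH (n - 1)%N) ?(IH (n + 2 * 1)%N) ?(IH (n - 4)%N) ?(IH (n + 2 * 4)%N);
  rewrite ?inE ?eqxx ?orbT //.
rewrite !natrB ?natrD ?natrM; [|lia|lia].
move=> e1 e4.
(* The squares of [f n] cancel in the difference of the two equations, leaving 9 f(n) = 9 n. *)
have n9 : 9%:R != 0 :> K by rewrite pnatr_eq0.
apply: (mulfI n9); move/eqP: e1; rewrite -subr_eq0 => /eqP e1.
move/eqP: e4; rewrite -subr_eq0 => /eqP e4.
apply/eqP; rewrite -subr_eq0; apply/eqP.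
rewrite -[RHS](subrr 0) -{1}e4 -e1; ring.
Qed.

(** * The strong induction *)

Theorem theorem1 (R : realType) (f : nat -> R[i])
  (f_mult : multiplicative_fun f)
  (f_eq : forall x y : nat, (0 < x)%N -> (0 < y)%N ->
     f (x ^ 2 + x * y + y ^ 2)%N = f x ^+ 2 + f x * f y + f y ^+ 2) :
  forall n : nat, (0 < n)%N -> f n = n%:R.
Proof.
have fE : eisenstein_commuting f by move=> x y n x0 y0 ->; apply: f_eq.
have fM := multiplicative_funM f_mult.
elim/ltn_ind => n IH n0.
have [n1|n_gt1] : n = 1%N \/ (1 < n)%N by lia.
  by rewrite n1; case: f_mult.
have [n2|nn2] := eqVneq (n %% 3)%N 2%N.
  have [->|n4] : n = 2%N \/ (4 < n)%N by lia.
    exact: (commuting_2 f_mult fE).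
  have above m : m = (n + 2)%N \/ m = (n + 8)%N -> f m = m%:R.
    move=> m_n; have m_gt1 : (1 < m)%N by lia.
    have [[p [j [p_pr em]]]|[a [b [a1 b1 cop em]]]] :=
        prime_power_or_coprime_product m_gt1.
      rewrite em (commuting_prime_power_1mod3 f_mult fE) // -em; first by lia.
      by move=> r r0 rm; apply: IH => //; nia.
    (* If c >= n, then m <= n + 8 < 3n forces d = 2. The only such factorization is 16 = 8 * 2 at n
       = 8, which is not coprime. *)
    have small c d : (1 < c)%N -> (1 < d)%N -> coprime c d -> m = (c * d)%N ->
        (c < n)%N.
      move=> c1 d1 cd ecd; rewrite ltnNge; apply/negP => nc.
      have d2 : d = 2%N by nia.
      rewrite d2 in cd ecd; move: cd; rewrite coprime_sym prime_coprime //.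
      lia.
    rewrite (fM a b) //; [|lia|lia].
    rewrite !IH ?em ?natrM //; try lia.
    - by apply: (small b a) => //; rewrite 1?coprime_sym // mulnC.
    - exact: (small a b).
  apply: (commuting_2mod3 f_mult fE) => // m.
  rewrite !inE => /or4P[] /eqP ->; try (by apply: above; tauto);
    by apply: IH; lia.
have [[p [j [p_pr en]]]|[a [b [a1 b1 cop en]]]] :=
    prime_power_or_coprime_product n_gt1; last first.
  by rewrite (fM a b) ?IH ?en ?natrM //; nia.
have [n3|n3] := eqVneq (n %% 3)%N 1%N.
  rewrite en (commuting_prime_power_1mod3 f_mult fE) // -en //.
  by move=> r r0 rn; apply: IH => //; nia.
(* Only the residue 0 remains, so n is a power of 3: either r^2, or 3 r^2, the norm of (r, r). *)
have p3 : p = 3%N.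
  have : (3 %| n)%N by rewrite /dvdn; lia.
  by rewrite en Euclid_dvdX // dvdn_prime2 // => /andP[/eqP].
move: en; rewrite p3 -(odd_double_half j) -muln2 expnD expnM.
set r := (3 ^ j./2)%N; have r0 : (0 < r)%N by rewrite expn_gt0.
case: (odd j) => /= en.
- rewrite (fE r r n) // ?IH ?en //; [ring | nia | ring].
- move: en; rewrite mul1n => en.
  by rewrite en (commuting_sqr f_mult fE) // IH ?en ?natrX //; nia.
Qed.
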